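(* Let $N\ge 1$ be an integer, $\sigma>0$ and $R>0$. Let $Q\in C([0,R])$ be a non-negative function such that the limit $$L_0:=\lim_{r\to 0^+}\frac{Q(r)}{r^2}$$ exists and belongs to $(0,\infty)$. Then there exists a unique solution $\phi\in C^1([0,R))$ to the Riccati equation $$\phi'(r)=-r\,\phi(r)^2-\frac{N}{r}\phi(r)+\frac{Q(r)}{\sigma^4 r},\qquad r\in(0,R),$$ such that $\phi(0)=0$. *)

(* Defs.v *)
From Stdlib Require Import Reals.
From Coquelicot Require Import Coquelicot.

Local Open Scope R_scope.

(* The filter [within D (locally x)] makes this [is_derive] relative to [D]:
   it is the one-sided derivative when [x] is an endpoint of an interval [D]
   and agrees with [is_derive] when [x] is interior to [D]. *)
Definition is_derive_on (D : R -> Prop) (f : R -> R) (x l : R) : Prop :=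
  filterdiff f (within D (locally x)) (fun y : R => scal y l).

Definition C1_on (D : R -> Prop) (f : R -> R) : Prop :=
  exists df : R -> R,
    continuous_on D df /\ forall x : R, D x -> is_derive_on D f x (df x).

(* [rmax] is the right end of the interval; values of [phi] outside
   [0, rmax) are irrelevant. *)
Definition riccati_solution (N : nat) (sigma rmax : R) (Q phi : R -> R) : Prop :=
  C1_on (fun r => 0 <= r < rmax) phi /\
  (forall r : R, 0 < r < rmax ->
     is_derive phi r
       (- r * phi r ^ 2 - INR N / r * phi r + Q r / (sigma ^ 4 * r))) /\
  phi 0 = 0.

(* Main.v *)
Require Import Defs.
From Stdlib Require Import Reals Lra Lia.
From Coquelicot Require Import Coquelicot.

Local Open Scope R_scope.

(** A Riccati equation becomes linear when the unknown is written as a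
    quotient.  Put [p r = Q r / (sigma ^ 4 * r)], which extends continuously
    by [0] at the origin because [Q r] is of order [r ^ 2].  If
    [w' = r * y] and [y' = - (N / r) * y + p * w], then [phi = y / w] satisfies
    [phi' = y' / w - y * w' / w ^ 2 = - r * phi ^ 2 - (N / r) * phi + p].

    The second linear equation is an Euler equation, whose solution vanishing
    at [0] is [y r = r ^ (- N) * integral from 0 to r of s ^ N * p s * w s];
    so the system amounts to the Volterra equation
    [w r = 1 + integral from 0 to r of t * y t].  Its right-hand side is a
    contraction for the sup norm weighted by [exp (k * r)] with [k] large, so it
    has a solution on the whole of [[0, rmax]]
    ([weighted_contraction_fixed_point], [linearized_fixed_point]).  As
    [p >= 0], the solution satisfies [w >= 1]: the quotient never blows up, and
    this is why [phi] exists up to [rmax] ([riccati_solution_exists]).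

    At the origin [|y r| <= r * sup |p * w|] with a supremum over [[0, r]] that
    tends to [p 0 * w 0 = 0].  Hence [y] and [phi] are [o(r)], which gives
    [phi' 0 = 0], and the three terms of the equation tend to [0] as well, so
    that [phi] is [C^1] up to [0].

    For uniqueness, the difference [d] of two solutions [phi] and [psi]
    satisfies [d' = - (r * (phi + psi) + N / r) * d].  The singular term
    [N / r] only damps, and [r * (phi + psi)] is bounded by some [K] on each
    [[0, r0]]; therefore [d ^ 2 * exp (- 2 * K * r)] is nonincreasing and it
    vanishes at [0] ([riccati_unique]).

    Division by zero yields zero, so [phi r / r] and [Q r / (sigma ^ 4 * r)]
    take at [r = 0] the values of their continuous extensions.  One formula for
    [phi'] thus serves on the half-open interval, origin included. *)

(** * Functions restricted to a segment *)

(** Composing with [clamp a b] turns a function continuous on [[a, b]] into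
    one continuous on the line, with the same values on [[a, b]].  Integrals,
    derivatives and the mean value theorem can then be used without one-sided
    variants at the end points. *)
Definition clamp (a b x : R) : R := Rmax a (Rmin x b).

Lemma clamp_bounds (a b x : R) : a <= b -> a <= clamp a b x <= b.
Proof.
  intros hab. unfold clamp, Rmax, Rmin.
  destruct (Rle_dec x b); destruct (Rle_dec a _); lra.
Qed.

Lemma clamp_id (a b x : R) : a <= x <= b -> clamp a b x = x.
Proof.
  intros hx. unfold clamp, Rmax, Rmin.
  destruct (Rle_dec x b); destruct (Rle_dec a _); lra.
Qed.

Lemma clamp_nonexpansive (a b x y : R) :
  a <= b -> Rabs (clamp a b y - clamp a b x) <= Rabs (y - x).
Proof.
  intros hab. unfold clamp, Rmax, Rmin.
  destruct (Rle_dec x b); destruct (Rle_dec y b);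
  repeat destruct (Rle_dec a _); unfold Rabs;
  repeat destruct (Rcase_abs _); lra.
Qed.

Lemma continuous_clamp_comp (a b : R) (f : R -> R) (x : R) :
  a <= b -> continuous_on (fun y => a <= y <= b) f ->
  continuous (fun y => f (clamp a b y)) x.
Proof.
  intros hab hf.
  pose proof (hf (clamp a b x) (clamp_bounds a b x hab)) as h.
  refine (filterlim_comp _ _ _ (clamp a b) f _ _ _ _ h).
  intros P [d hd]. exists d. intros y hy.
  apply hd; [| now apply clamp_bounds].
  apply Rle_lt_trans with (2 := hy).
  now apply clamp_nonexpansive.
Qed.

Lemma continuous_within (D : R -> Prop) (f : R -> R) (x : R) :
  continuous f x -> filterlim f (within D (locally x)) (locally (f x)).
Proof.
  intros hf. apply filterlim_filter_le_1 with (2 := hf). apply filter_le_within.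
Qed.

Lemma continuous_clamped (a b : R) (f : R -> R) (x : R) :
  a <= b -> (forall y, continuous f y) -> continuous (fun y => f (clamp a b y)) x.
Proof.
  intros hab hf. apply continuous_clamp_comp; [easy |].
  intros y _. apply continuous_within, hf.
Qed.

Lemma continuous_bounded_segment (a b : R) (f : R -> R) :
  a <= b -> (forall x, continuous f x) ->
  exists M, 0 <= M /\ forall x, a <= x <= b -> Rabs (f x) <= M.
Proof.
  intros hab hf.
  destruct (continuity_ab_maj (fun x => Rabs (f x)) a b hab) as [m [hm _]].
  - intros c _. apply continuity_pt_filterlim.
    apply (continuous_comp f Rabs); [apply hf | apply continuous_Rabs].
  - exists (Rabs (f m)). split; [apply Rabs_pos | apply hm].
Qed.

Lemma ex_RInt_of_continuous (f : R -> R) (a b : R) :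
  (forall x, continuous f x) -> ex_RInt f a b.
Proof. intros hf. apply (ex_RInt_continuous (V := R_CompleteNormedModule)). intros z _. apply hf. Qed.

Lemma is_derive_RInt_continuous (f : R -> R) (a r : R) :
  (forall x, continuous f x) -> is_derive (fun x => RInt f a x) r (f r).
Proof.
  intros hf. apply (is_derive_RInt f (fun x => RInt f a x) a r); [| apply hf].
  apply filter_forall. intros x.
  apply (RInt_correct f a x), ex_RInt_of_continuous, hf.
Qed.

Lemma continuous_of_is_derive (f : R -> R) (x l : R) :
  is_derive f x l -> continuous f x.
Proof. intros h. apply (ex_derive_continuous f x). now exists l. Qed.

(** * A fixed point theorem *)

(** Banach's theorem for the norm [sup |f / weight|] on [[a, b]]: the iterates
    of [T] started at [0] differ by a geometric sequence times [weight], so they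
    converge uniformly.  Letting the weight vary along the segment is what makes
    an integral operator a contraction on a segment of any length.  The map [T]
    acts on functions of the whole line, whereas only their values on [[a, b]]
    are compared. *)
Lemma weighted_contraction_fixed_point (a b : R) (weight : R -> R)
  (T : (R -> R) -> R -> R) :
  a <= b -> (forall x, continuous weight x) ->
  (forall x, a <= x <= b -> 1 <= weight x) ->
  (forall f : R -> R,
     (forall x, continuous f x) -> forall x, continuous (T f) x) ->
  (forall (f g : R -> R) (c : R), (forall x, continuous f x) -> (forall x, continuous g x) ->
     0 <= c -> (forall x, a <= x <= b -> Rabs (f x - g x) <= c * weight x) ->
     forall x, a <= x <= b -> Rabs (T f x - T g x) <= c / 2 * weight x) ->
  exists w : R -> R, (forall x, continuous w x) /\
    forall x, a <= x <= b -> T w x = w x.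
Proof.
  intros hab hwc hw1 hTc hT.
  set (u := fun n => Nat.iter n T (fun _ => 0)).
  assert (huc : forall n x, continuous (u n) x).
  { induction n as [| n IH].
    - intros x. apply continuous_const.
    - apply (hTc _ IH). }
  destruct (continuous_bounded_segment a b (u 1%nat) hab (huc 1%nat)) as [D [hD0 hD]].
  destruct (continuous_bounded_segment a b weight hab hwc) as [K [hK0 hK]].
  assert (hpow : forall n, 0 < (/ 2) ^ n) by (intros n; apply pow_lt; lra).
  assert (hstep : forall n x, a <= x <= b ->
            Rabs (u (S n) x - u n x) <= D * (/ 2) ^ n * weight x).
  { induction n as [| n IH].
    - intros x hx. specialize (hD x hx). specialize (hw1 x hx).
      change (u 0%nat x) with 0. rewrite Rminus_0_r. simpl pow. nra.
    - intros x hx.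
      replace (D * (/ 2) ^ S n) with (D * (/ 2) ^ n / 2) by (simpl; field).
      apply (hT (u (S n)) (u n)); auto.
      apply Rmult_le_pos; [easy | apply Rlt_le, hpow]. }
  assert (hcum : forall n k x, a <= x <= b ->
            Rabs (u (k + n)%nat x - u n x)
            <= 2 * D * (/ 2) ^ n * (1 - (/ 2) ^ k) * weight x).
  { intros n k x hx. induction k as [| k IH].
    - simpl. rewrite Rminus_diag, Rabs_R0. lra.
    - replace (u (S k + n)%nat x - u n x)
        with ((u (S (k + n)) x - u (k + n)%nat x) + (u (k + n)%nat x - u n x))
        by (change (S k + n)%nat with (S (k + n)); ring).
      eapply Rle_trans; [apply Rabs_triang |].
      specialize (hstep (k + n)%nat x hx). rewrite pow_add in hstep.
      simpl pow. lra. }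
  assert (hfar : forall n m x, (n <= m)%nat -> a <= x <= b ->
            Rabs (u m x - u n x) <= 2 * D * (/ 2) ^ n * weight x).
  { intros n m x hnm hx. replace m with ((m - n) + n)%nat by lia.
    eapply Rle_trans; [apply hcum, hx |].
    specialize (hw1 x hx).
    assert (0 <= D * (/ 2) ^ n * (/ 2) ^ (m - n) * weight x).
    { repeat apply Rmult_le_pos; try (apply Rlt_le, hpow); lra. }
    lra. }
  assert (hsmall : forall C eps, 0 < eps ->
            exists n, forall m, (n <= m)%nat -> C * (/ 2) ^ m < eps).
  { intros C eps heps.
    assert (hl : is_lim_seq (fun n => C * (/ 2) ^ n) 0).
    { replace (Finite 0) with (Rbar_mult C 0) by (simpl; f_equal; ring).
      apply is_lim_seq_scal_l, is_lim_seq_geom. rewrite Rabs_pos_eq; lra. }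
    apply is_lim_seq_spec in hl. destruct (hl (mkposreal eps heps)) as [n hn].
    exists n. intros m hm. specialize (hn m hm). simpl in hn.
    rewrite Rminus_0_r in hn. apply Rle_lt_trans with (2 := hn), Rle_abs. }
  assert (hlim : forall x, a <= x <= b ->
            is_lim_seq (fun n => u n x) (real (Lim_seq (fun n => u n x)))).
  { intros x hx. apply (Lim_seq_correct' (fun n => u n x)).
    apply ex_lim_seq_cauchy_corr. intros eps.
    destruct (hsmall (4 * D * weight x) eps (cond_pos eps)) as [n hn].
    specialize (hn n (le_n n)).
    exists n. intros i j hi hj.
    replace (u i x - u j x) with ((u i x - u n x) - (u j x - u n x)) by ring.
    eapply Rle_lt_trans; [apply Rabs_triang |]. rewrite Rabs_Ropp.
    pose proof (hfar n i x hi hx). pose proof (hfar n j x hj hx). lra. }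
  (* The clamp extends the limit continuously beyond the segment, where the
     iterates need not converge. *)
  set (w := fun x => real (Lim_seq (fun n => u n (clamp a b x)))).
  assert (hwu : forall n x, a <= x <= b ->
            Rabs (w x - u n x) <= 2 * D * (/ 2) ^ n * weight x).
  { intros n x hx. unfold w. rewrite clamp_id by easy.
    apply (is_lim_seq_le (fun m => Rabs (u (m + n)%nat x - u n x))
             (fun _ => 2 * D * (/ 2) ^ n * weight x)
             (Rabs (real (Lim_seq (fun m => u m x)) - u n x))
             (2 * D * (/ 2) ^ n * weight x)).
    - intros m. apply hfar; [lia | easy].
    - apply (is_lim_seq_abs _ (Finite _)).
      apply (is_lim_seq_minus' _ _ _ _).
      + apply (is_lim_seq_incr_n (fun m => u m x) n), hlim, hx.
      + apply is_lim_seq_const.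
    - apply is_lim_seq_const. }
  assert (hwcl : forall x, w (clamp a b x) = w x).
  { intros x. unfold w. rewrite (clamp_id _ _ (clamp a b x)); [easy |].
    now apply clamp_bounds. }
  assert (hcw : forall x, continuous w x).
  { intros x. apply continuity_pt_filterlim.
    apply (CVU_continuity (fun n y => u n (clamp a b y)) w x (mkposreal 1 Rlt_0_1)).
    - intros eps heps. destruct (hsmall (2 * D * K) eps heps) as [n hn].
      exists n. intros m y hm _. rewrite <- hwcl.
      pose proof (clamp_bounds a b y hab) as hy.
      apply Rle_lt_trans with (2 := hn m hm).
      eapply Rle_trans; [apply hwu, hy |].
      specialize (hK _ hy). pose proof (Rle_abs (weight (clamp a b y))).
      specialize (hpow m).
      replace (2 * D * K * (/ 2) ^ m) with (2 * D * (/ 2) ^ m * K) by ring.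
      apply Rmult_le_compat_l; [| lra].
      apply Rmult_le_pos; lra.
    - intros n y _. apply continuity_pt_filterlim.
      apply continuous_clamped; auto.
    - unfold Boule. rewrite Rminus_diag, Rabs_R0. apply Rlt_0_1. }
  exists w. split; [easy |]. intros x hx.
  apply Rminus_diag_uniq. apply Rabs_eq_0.
  apply Rle_antisym; [| apply Rabs_pos].
  apply le_epsilon. intros eps heps.
  destruct (hsmall (2 * D * weight x) eps heps) as [n hn].
  specialize (hn n (le_n n)).
  assert (h1 : Rabs (T w x - u (S n) x) <= 2 * D * (/ 2) ^ n / 2 * weight x).
  { apply (hT w (u n)); auto. apply Rmult_le_pos; [lra | apply Rlt_le, hpow]. }
  pose proof (hwu (S n) x hx) as h2. rewrite Rabs_minus_sym in h2. simpl pow in h2.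
  replace (T w x - w x) with ((T w x - u (S n) x) + (u (S n) x - w x)) by ring.
  eapply Rle_trans; [apply Rabs_triang |]. lra.
Qed.

(** * The Euler equation y' + (N / r) y = f *)

(** The solution, for [r > 0], of [y' + (N / r) * y = f] that vanishes at
    [0]; it is extended by [0] to the left of the origin. *)
Definition euler_primitive (N : nat) (f : R -> R) (r : R) : R :=
  if Rle_dec r 0 then 0 else RInt (fun s => s ^ N * f s) 0 r / r ^ N.

Lemma euler_primitive_nonpos (N : nat) (f : R -> R) (r : R) :
  r <= 0 -> euler_primitive N f r = 0.
Proof. intros hr. unfold euler_primitive. now destruct (Rle_dec r 0). Qed.

Lemma euler_primitive_pos (N : nat) (f : R -> R) (r : R) :
  0 < r -> euler_primitive N f r = RInt (fun s => s ^ N * f s) 0 r / r ^ N.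
Proof. intros hr. unfold euler_primitive. destruct (Rle_dec r 0); lra. Qed.

Lemma continuous_Rmult (f g : R -> R) (x : R) :
  continuous f x -> continuous g x -> continuous (fun s => f s * g s) x.
Proof. exact (continuous_mult f g x). Qed.

Lemma continuous_pow (n : nat) (x : R) : continuous (fun s => s ^ n) x.
Proof.
  apply (ex_derive_continuous (fun s => s ^ n) x).
  auto_derive. easy.
Qed.

Lemma continuous_pow_mult (n : nat) (f : R -> R) :
  (forall x, continuous f x) -> forall x, continuous (fun s => s ^ n * f s) x.
Proof.
  intros hf x. apply (continuous_Rmult (fun s => s ^ n) f); [| apply hf].
  apply continuous_pow.
Qed.

(** Since [s ^ N <= r ^ N] on [[0, r]], the factor [r ^ (- N)] is absorbed and
    only the length of the interval remains. *)
Lemma euler_primitive_bound (N : nat) (f : R -> R) (r c : R) :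
  (forall x, continuous f x) -> 0 <= r ->
  (forall s, 0 <= s <= r -> Rabs (f s) <= c) ->
  Rabs (euler_primitive N f r) <= r * c.
Proof.
  intros hf hr hc.
  destruct (Rle_lt_or_eq_dec 0 r hr) as [hpos | <-].
  2: rewrite euler_primitive_nonpos, Rabs_R0; lra.
  rewrite euler_primitive_pos by easy.
  pose proof (pow_lt r N hpos) as hrN.
  rewrite Rabs_div, (Rabs_pos_eq (r ^ N)) by lra.
  apply Rle_div_l; [easy |].
  replace (r * c * r ^ N) with ((r - 0) * (r ^ N * c)) by ring.
  apply abs_RInt_le_const; [easy | |].
  - now apply ex_RInt_of_continuous, continuous_pow_mult.
  - intros t ht. rewrite Rabs_mult, (Rabs_pos_eq (t ^ N)) by (now apply pow_le).
    apply Rmult_le_compat; [now apply pow_le | apply Rabs_pos | | now apply hc].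
    now apply pow_incr.
Qed.

Lemma euler_primitive_nonneg (N : nat) (f : R -> R) (r : R) :
  (forall x, continuous f x) -> (forall x, 0 <= f x) ->
  0 <= euler_primitive N f r.
Proof.
  intros hf hpos. destruct (Rle_lt_dec r 0) as [hr | hr].
  - rewrite euler_primitive_nonpos; lra.
  - rewrite euler_primitive_pos by easy.
    apply Rdiv_le_0_compat; [| now apply pow_lt].
    apply RInt_ge_0; [lra | |].
    + now apply ex_RInt_of_continuous, continuous_pow_mult.
    + intros x hx. apply Rmult_le_pos; [apply pow_le; lra | apply hpos].
Qed.

Lemma euler_primitive_minus (N : nat) (f g : R -> R) (r : R) :
  (forall x, continuous f x) -> (forall x, continuous g x) ->
  euler_primitive N f r - euler_primitive N g r
  = euler_primitive N (fun x => f x - g x) r.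
Proof.
  intros hf hg. destruct (Rle_lt_dec r 0) as [hr | hr].
  - rewrite !euler_primitive_nonpos by easy. ring.
  - rewrite !euler_primitive_pos by easy.
    unfold Rdiv. rewrite <- Rmult_minus_distr_r. f_equal.
    symmetry. etransitivity.
    2: exact (RInt_minus (V := R_CompleteNormedModule)
            (fun s => s ^ N * f s) (fun s => s ^ N * g s) 0 r
            (ex_RInt_of_continuous _ 0 r (continuous_pow_mult N f hf))
            (ex_RInt_of_continuous _ 0 r (continuous_pow_mult N g hg))).
    apply RInt_ext. intros x _. unfold minus, plus, opp; simpl. ring.
Qed.

Lemma is_derive_euler_primitive (N : nat) (f : R -> R) (r : R) :
  (forall x, continuous f x) -> 0 < r ->
  is_derive (euler_primitive N f) r (f r - INR N / r * euler_primitive N f r).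
Proof.
  intros hf hr.
  apply is_derive_ext_loc
    with (fun x => RInt (fun s => s ^ N * f s) 0 x / x ^ N).
  - assert (hnear : forall x : R, Rabs (x - r) < r ->
              RInt (fun s => s ^ N * f s) 0 x / x ^ N = euler_primitive N f x).
    { intros x hx. apply Rabs_def2 in hx as [_ hx].
      symmetry. apply euler_primitive_pos. lra. }
    exists (mkposreal r hr). exact hnear.
  - pose proof (pow_lt r N hr) as hrN.
    rewrite euler_primitive_pos by easy.
    evar_last.
    + apply is_derive_div.
      * apply is_derive_RInt_continuous, continuous_pow_mult, hf.
      * apply is_derive_Reals, derivable_pt_lim_pow.
      * lra.
    + destruct N as [| n].
      * simpl. field. lra.
      * simpl pred. rewrite <- tech_pow_Rmult. field.
        split; apply Rgt_not_eq; [now apply pow_lt | easy].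
Qed.

Lemma continuous_euler_primitive (N : nat) (f : R -> R) :
  (forall x, continuous f x) -> forall r, continuous (euler_primitive N f) r.
Proof.
  intros hf r. destruct (Rle_lt_dec r 0) as [hr | hr].
  2: now eapply continuous_of_is_derive, is_derive_euler_primitive.
  destruct (continuous_bounded_segment 0 1 f Rle_0_1 hf) as [M [hM0 hM]].
  apply continuity_pt_filterlim. intros eps heps.
  assert (hd : 0 < eps / (M + 1)) by (apply Rdiv_lt_0_compat; lra).
  exists (Rmin 1 (eps / (M + 1))).
  split; [apply Rmin_glb_lt; lra |].
  intros x [_ hx]. simpl in hx |- *. unfold R_dist in *.
  rewrite (euler_primitive_nonpos N f r hr), Rminus_0_r.
  destruct (Rle_lt_dec x 0) as [hx0 | hx0].
  { rewrite euler_primitive_nonpos, Rabs_R0; easy. }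
  rewrite Rabs_pos_eq in hx by lra.
  pose proof (Rmin_l 1 (eps / (M + 1))). pose proof (Rmin_r 1 (eps / (M + 1))).
  apply Rle_lt_trans with (x * M).
  - apply euler_primitive_bound; [easy | lra |].
    intros s hs. apply hM. lra.
  - assert (h : x < eps / (M + 1)) by lra.
    apply Rlt_div_r in h; [nra | lra].
Qed.

(** When [f] vanishes at [0], [euler_primitive_bound] makes the primitive
    [o(r)] at the right of [0]; it is zero at the left. *)
Lemma is_derive_euler_primitive_0 (N : nat) (f : R -> R) :
  (forall x, continuous f x) -> f 0 = 0 -> is_derive (euler_primitive N f) 0 0.
Proof.
  intros hf hf0. apply is_derive_Reals. intros eps heps.
  pose proof (proj2 (continuity_pt_filterlim f 0) (hf 0)) as hc.
  destruct (hc (eps / 2)) as [d [hd hfd]]; [lra |].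
  assert (hsmall : forall s, 0 <= s < d -> Rabs (f s) <= eps / 2).
  { intros s hs. destruct (Req_dec s 0) as [-> | hs0].
    - rewrite hf0, Rabs_R0. lra.
    - specialize (hfd s). simpl in hfd. unfold R_dist in hfd.
      rewrite hf0, !Rminus_0_r in hfd. apply Rlt_le, hfd.
      repeat split; [congruence |]. rewrite Rabs_pos_eq; lra. }
  exists (mkposreal d hd). intros h hh0 hh. simpl in hh.
  rewrite Rplus_0_l, Rminus_0_r.
  rewrite (euler_primitive_nonpos N f 0 (Rle_refl 0)), Rminus_0_r.
  destruct (Rle_lt_dec h 0) as [hneg | hpos].
  - rewrite euler_primitive_nonpos by easy.
    unfold Rdiv. rewrite Rmult_0_l, Rabs_R0. easy.
  - rewrite Rabs_pos_eq in hh by lra.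
    rewrite Rabs_div, (Rabs_pos_eq h) by lra.
    apply Rle_lt_trans with (eps / 2); [| lra].
    apply Rle_div_l; [easy |]. rewrite Rmult_comm.
    apply euler_primitive_bound; [easy | lra |].
    intros s hs. apply hsmall. lra.
Qed.

(** * The linearized equation *)

Lemma exp_le_compat (x y : R) : x <= y -> exp x <= exp y.
Proof.
  intros [h | ->]; [apply Rlt_le, exp_increasing, h | apply Rle_refl].
Qed.

(** The Volterra equation for [w], with [|w|] in place of [w].  The operator
    remains a contraction, and for [p >= 0] every one of its values is at least
    [1] on [[0, rmax]]; so the fixed point is positive at once, and the absolute
    value disappears. *)
Lemma linearized_fixed_point (N : nat) (rmax : R) (p : R -> R) :
  0 < rmax -> (forall x, continuous p x) ->
  exists w : R -> R, (forall x, continuous w x) /\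
    forall r, 0 <= r <= rmax ->
      1 + RInt (fun t => t * euler_primitive N (fun s => p s * Rabs (w s)) t) 0 r
      = w r.
Proof.
  intros hrmax hp.
  destruct (continuous_bounded_segment 0 rmax p) as [M [hM0 hM]]; [lra | easy |].
  (* If |f - g| <= c exp (k r), the integrands differ by at most
     rmax ^ 2 M c exp (k t), whose integral is at most
     (rmax ^ 2 M / k) c exp (k r); this k makes the factor at most 1/2. *)
  set (k := 2 * (rmax ^ 2 * M) + 1).
  assert (hk : 0 < k).
  { assert (0 <= rmax ^ 2 * M) by (apply Rmult_le_pos; [apply pow2_ge_0 | easy]).
    unfold k. lra. }
  assert (hpf : forall f : R -> R, (forall x, continuous f x) ->
                  forall x, continuous (fun s => p s * Rabs (f s)) x).
  { intros f hf x. apply (continuous_Rmult p (fun s => Rabs (f s))); [apply hp |].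
    apply (continuous_comp f Rabs); [apply hf | apply continuous_Rabs]. }
  assert (hint : forall f : R -> R, (forall x, continuous f x) -> forall x,
     continuous (fun t => t * euler_primitive N (fun s => p s * Rabs (f s)) t) x).
  { intros f hf x. apply (continuous_Rmult (fun t => t)); [apply continuous_id |].
    apply continuous_euler_primitive, hpf, hf. }
  apply (weighted_contraction_fixed_point 0 rmax (fun r => exp (k * r))
     (fun f r =>
        1 + RInt (fun t => t * euler_primitive N (fun s => p s * Rabs (f s)) t) 0 r)).
  - lra.
  - intros x. apply (ex_derive_continuous (fun r => exp (k * r)) x).
    auto_derive. easy.
  - intros x hx. rewrite <- exp_0. apply exp_le_compat. nra.
  - intros f hf x. apply (continuous_plus (fun _ => 1)); [apply continuous_const |].
    eapply continuous_of_is_derive. apply is_derive_RInt_continuous, hint, hf.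
  - intros f g c hf hg hc hfg r hr.
    set (c' := rmax ^ 2 * M * c).
    assert (hc' : 0 <= c').
    { unfold c'. apply Rmult_le_pos; [| easy].
      apply Rmult_le_pos; [apply pow2_ge_0 | easy]. }
    match goal with |- Rabs ((1 + ?A) - (1 + ?B)) <= _ =>
      replace ((1 + A) - (1 + B)) with (minus A B)
        by (unfold minus, plus, opp; simpl; ring) end.
    rewrite <- (RInt_minus (V := R_CompleteNormedModule))
      by (now apply ex_RInt_of_continuous, hint).
    apply Rle_trans with (c' / k * exp (k * r) - c' / k * exp (k * 0)).
    + refine (norm_RInt_le (V := R_NormedModule) _ (fun t => c' * exp (k * t))
                0 r _ _ (proj1 hr) _ _ _).
      3:{ apply (is_RInt_derive (fun t => c' / k * exp (k * t))
                   (fun t => c' * exp (k * t))).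
          - intros x _. auto_derive; [easy |]. field. lra.
          - intros x _. apply (ex_derive_continuous (fun t => c' * exp (k * t)) x).
            auto_derive. easy. }
      2:{ apply (RInt_correct (V := R_CompleteNormedModule)).
          apply ex_RInt_of_continuous. intros x.
          apply (continuous_minus (V := R_NormedModule)); now apply hint. }
      intros t ht.
      change (Rabs (t * euler_primitive N (fun s => p s * Rabs (f s)) t
                    - t * euler_primitive N (fun s => p s * Rabs (g s)) t)
              <= c' * exp (k * t)).
      rewrite <- Rmult_minus_distr_l, euler_primitive_minus by (now apply hpf).
      rewrite Rabs_mult, (Rabs_pos_eq t) by easy.
      apply Rle_trans with (t * (t * (M * (c * exp (k * t))))).
      * apply Rmult_le_compat_l; [easy |].
        apply euler_primitive_bound; [| easy |].
        -- intros x. apply (continuous_minus (V := R_NormedModule)); now apply hpf.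
        -- intros s hs. rewrite <- Rmult_minus_distr_l, Rabs_mult.
           apply Rmult_le_compat; try apply Rabs_pos.
           { apply hM. lra. }
           apply Rle_trans with (c * exp (k * s)).
           { eapply Rle_trans; [apply Rabs_triang_inv2 |]. apply hfg. lra. }
           apply Rmult_le_compat_l; [easy |]. apply exp_le_compat.
           apply Rmult_le_compat_l; lra.
      * unfold c'. pose proof (exp_pos (k * t)).
        assert (h : 0 <= M * (c * exp (k * t))).
        { apply Rmult_le_pos; [easy |]. apply Rmult_le_pos; lra. }
        assert (h2 : t * t <= rmax ^ 2) by nra.
        replace (rmax ^ 2 * M * c * exp (k * t))
          with (rmax ^ 2 * (M * (c * exp (k * t)))) by ring.
        rewrite <- Rmult_assoc. now apply Rmult_le_compat_r.
    + pose proof (exp_pos (k * r)). pose proof (exp_pos (k * 0)).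
      assert (h : c' / k <= c / 2).
      { apply Rle_div_l; [easy |]. unfold c', k. nra. }
      assert (0 <= c' / k) by (apply Rdiv_le_0_compat; easy).
      nra.
Qed.

(** * Existence *)

(** The quotient [y / w].  At [r = 0] the right-hand side below reads [0], since
    [phi 0 / 0 = 0] and [p 0 = 0]; so the formula includes [phi' 0 = 0]. *)
Lemma riccati_solution_exists (N : nat) (rmax : R) (p : R -> R) :
  0 < rmax -> (forall x, continuous p x) -> (forall x, 0 <= p x) -> p 0 = 0 ->
  exists phi : R -> R, phi 0 = 0 /\
    forall r, 0 <= r < rmax ->
      is_derive phi r (- r * phi r ^ 2 - INR N * (phi r / r) + p r).
Proof.
  intros hrmax hp hp0 hpz.
  destruct (linearized_fixed_point N rmax p hrmax hp) as [w [hw hfix]].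
  set (f := fun s => p s * Rabs (w s)) in hfix.
  assert (hf : forall x, continuous f x).
  { intros x. apply (continuous_Rmult p (fun s => Rabs (w s))); [apply hp |].
    apply (continuous_comp w Rabs); [apply hw | apply continuous_Rabs]. }
  assert (hf0 : forall x, 0 <= f x).
  { intros x. apply Rmult_le_pos; [apply hp0 | apply Rabs_pos]. }
  set (y := euler_primitive N f) in hfix.
  set (W := fun r => 1 + RInt (fun t => t * y t) 0 r).
  assert (hty : forall x, continuous (fun t => t * y t) x).
  { intros x. apply (continuous_Rmult (fun t => t)); [apply continuous_id |].
    apply continuous_euler_primitive, hf. }
  assert (hW : forall r, is_derive W r (r * y r)).
  { intros r. replace (r * y r) with (0 + r * y r) by ring.
    apply (is_derive_plus (fun _ => 1) (fun r => RInt (fun t => t * y t) 0 r)).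
    - apply (is_derive_const (K := R_AbsRing) 1).
    - apply (is_derive_RInt_continuous (fun t => t * y t)), hty. }
  assert (hW1 : forall r, 0 <= r -> 1 <= W r).
  { intros r hr. unfold W.
    assert (0 <= RInt (fun t => t * y t) 0 r); [| lra].
    apply RInt_ge_0; [easy | apply ex_RInt_of_continuous, hty |].
    intros x hx. apply Rmult_le_pos; [lra |].
    now apply euler_primitive_nonneg. }
  exists (fun r => y r / W r).
  assert (hy0 : y 0 = 0) by (apply euler_primitive_nonpos, Rle_refl).
  split; [rewrite hy0; apply Rmult_0_l |].
  intros r hr. pose proof (hW1 r (proj1 hr)) as hWr.
  destruct (Rle_lt_or_eq_dec 0 r (proj1 hr)) as [hpos | <-].
  - assert (hfr : f r = p r * W r).
    { unfold f. f_equal. rewrite <- (hfix r) by lra. fold (W r).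
      apply Rabs_pos_eq. lra. }
    evar_last.
    + apply (is_derive_div y W).
      * apply is_derive_euler_primitive; easy.
      * apply hW.
      * lra.
    + fold (y r). rewrite hfr. field. lra.
  - evar_last.
    + apply (is_derive_div y W).
      * apply is_derive_euler_primitive_0; [easy |].
        unfold f. rewrite hpz. apply Rmult_0_l.
      * apply hW.
      * lra.
    + rewrite hy0, hpz. unfold Rdiv. rewrite !Rmult_0_l. ring.
Qed.

(** The term [(N / r) * phi] of the equation is continuous at the origin: it is
    [N] times a difference quotient of [phi], extended by [phi' 0 = 0]. *)
Lemma continuous_slope_0 (f : R -> R) :
  f 0 = 0 -> is_derive f 0 0 -> continuous (fun r => f r / r) 0.
Proof.
  intros hf0 hf. apply is_derive_Reals in hf.
  apply continuity_pt_filterlim. intros eps heps.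
  destruct (hf eps heps) as [d hd].
  exists d. split; [apply cond_pos |].
  intros x [[_ hx0] hx]. simpl in hx |- *. unfold R_dist in *.
  rewrite hf0. unfold Rdiv at 2. rewrite Rmult_0_l, Rminus_0_r.
  rewrite Rminus_0_r in hx. specialize (hd x (not_eq_sym hx0) hx).
  now rewrite Rplus_0_l, hf0, !Rminus_0_r in hd.
Qed.

(** * Uniqueness *)

(** The factor [exp (- 2 * K * r)] turns the bound [(d ^ 2)' <= 2 * K * d ^ 2] on
    the difference [d] into monotonicity of [E], and the sign of [- N / r]
    makes this bound hold in spite of the singularity. *)
Lemma riccati_unique (N : nat) (rmax : R) (h phi psi : R -> R) :
  continuous_on (fun r => 0 <= r < rmax) phi ->
  continuous_on (fun r => 0 <= r < rmax) psi ->
  (forall r, 0 < r < rmax ->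
     is_derive phi r (- r * phi r ^ 2 - INR N / r * phi r + h r)) ->
  (forall r, 0 < r < rmax ->
     is_derive psi r (- r * psi r ^ 2 - INR N / r * psi r + h r)) ->
  phi 0 = psi 0 ->
  forall r, 0 <= r < rmax -> psi r = phi r.
Proof.
  intros hphi hpsi dphi dpsi h0 r0 hr0.
  assert (hext : forall f : R -> R, continuous_on (fun r => 0 <= r < rmax) f ->
            forall x, continuous (fun r => f (clamp 0 r0 r)) x).
  { intros f hf x. apply continuous_clamp_comp; [easy |].
    intros y hy. apply filterlim_filter_le_1 with (2 := hf y ltac:(lra)).
    intros P. unfold within. apply filter_imp.
    intros z hz hz'. apply hz. lra. }
  pose proof (hext _ hphi) as cF. pose proof (hext _ hpsi) as cG.
  set (F := fun r => phi (clamp 0 r0 r)) in cF.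
  set (G := fun r => psi (clamp 0 r0 r)) in cG.
  assert (hder : forall f : R -> R, (forall r, 0 < r < rmax ->
              is_derive f r (- r * f r ^ 2 - INR N / r * f r + h r)) ->
            forall r, 0 < r < r0 ->
              is_derive (fun r => f (clamp 0 r0 r)) r
                (- r * f (clamp 0 r0 r) ^ 2 - INR N / r * f (clamp 0 r0 r) + h r)).
  { intros f hf r hr. rewrite clamp_id by lra.
    apply is_derive_ext_loc with f; [| apply hf; lra].
    apply (filter_imp (fun x : R => 0 < x < r0)).
    - intros x hx. f_equal. symmetry. apply clamp_id. lra.
    - apply (filter_and (fun x : R => 0 < x) (fun x : R => x < r0)).
      + apply open_gt, hr.
      + apply open_lt, hr. }
  pose proof (hder _ dphi) as dF. pose proof (hder _ dpsi) as dG.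
  fold F in dF. fold G in dG.
  assert (cS : forall x, continuous (fun r => r * (F r + G r)) x).
  { intros x. apply (continuous_Rmult (fun r => r)); [apply continuous_id |].
    apply (continuous_plus F G); [apply cF | apply cG]. }
  destruct (continuous_bounded_segment 0 r0 _ (proj1 hr0) cS) as [K [hK0 hK]].
  set (E := fun r => (F r - G r) ^ 2 * exp (- (2 * K) * r)).
  set (dE := fun r => - 2 * (r * (F r + G r) + INR N / r + K) * E r).
  destruct (MVT_gen E 0 r0 dE) as [c [hc hEc]].
  - rewrite Rmin_left, Rmax_right by easy. intros r hr.
    specialize (dF r hr). specialize (dG r hr).
    unfold E, dE. evar_last.
    + apply (is_derive_mult (fun r => (F r - G r) ^ 2)
               (fun r => exp (- (2 * K) * r))).
      * apply (is_derive_pow (fun r => F r - G r) 2).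
        apply (is_derive_minus F G); [exact dF | exact dG].
      * auto_derive; [easy | reflexivity].
      * intros; apply Rmult_comm.
    + unfold minus, plus, opp, mult; simpl. unfold mult; simpl. unfold E, F, G. field. lra.
  - intros x _. apply continuity_pt_filterlim.
    apply (continuous_Rmult (fun r => (F r - G r) ^ 2)
             (fun r => exp (- (2 * K) * r))).
    + apply (continuous_comp (fun r => F r - G r) (fun z => z ^ 2)).
      * apply (continuous_minus F G); [apply cF | apply cG].
      * apply continuous_pow.
    + apply (ex_derive_continuous (fun r => exp (- (2 * K) * r)) x).
      auto_derive. easy.
  - rewrite Rmin_left, Rmax_right in hc by easy.
    assert (hE : forall r, 0 <= E r).
    { intros r. apply Rmult_le_pos; [apply pow2_ge_0 | apply Rlt_le, exp_pos]. }
    assert (hE0 : E 0 = 0).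
    { unfold E, F, G. rewrite clamp_id by lra. rewrite h0. ring. }
    (* The mean value point c may be the end point 0, where N / c is 0. *)
    assert (hdE : dE c <= 0).
    { specialize (hK c hc). apply Rabs_le_between in hK.
      assert (0 <= INR N / c).
      { destruct (Rle_lt_or_eq_dec 0 c (proj1 hc)) as [hc0 | <-].
        - apply Rdiv_le_0_compat; [apply pos_INR | easy].
        - unfold Rdiv. rewrite Rinv_0. lra. }
      specialize (hE c).
      assert (0 <= (c * (F c + G c) + INR N / c + K) * E c)
        by (apply Rmult_le_pos; lra).
      unfold dE. lra. }
    assert (hEr : E r0 = 0) by (specialize (hE r0); nra).
    unfold E, F, G in hEr. rewrite clamp_id in hEr by lra.
    apply Rmult_integral in hEr. destruct hEr as [hEr | hEr].
    + simpl in hEr. nra.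
    + pose proof (exp_pos (- (2 * K) * r0)). lra.
Qed.

(** * The source term and derivatives relative to an interval *)

(** Near the origin [Q r / (sigma ^ 4 * r)] is the bounded function [Q r / r ^ 2]
    times [r / sigma ^ 4], so it tends to [0], which is also its value there. *)
Lemma riccati_source_continuous (sigma rmax L0 : R) (Q : R -> R) :
  0 < sigma ->
  continuous_on (fun r => 0 <= r <= rmax) Q ->
  filterlim (fun r => Q r / r ^ 2) (at_right 0) (locally L0) ->
  continuous_on (fun r => 0 <= r <= rmax) (fun r => Q r / (sigma ^ 4 * r)).
Proof.
  intros hsigma hQ hL0 x hx.
  pose proof (pow_lt sigma 4 hsigma) as hs.
  destruct (Rle_lt_or_eq_dec 0 x (proj1 hx)) as [hpos | <-].
  - apply (filterlim_comp_2 (G := locally (Q x)) (H := locally (/ (sigma ^ 4 * x)))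
             Q (fun r => / (sigma ^ 4 * r)) Rmult).
    + apply hQ, hx.
    + apply (continuous_within _ (fun r => / (sigma ^ 4 * r)) x).
      apply (ex_derive_continuous (fun r => / (sigma ^ 4 * r)) x).
      auto_derive. apply Rgt_not_eq. apply Rmult_lt_0_compat; easy.
    + apply (filterlim_mult (K := R_AbsRing) (Q x)).
  - rewrite Rmult_0_r. unfold Rdiv at 2. rewrite Rinv_0, Rmult_0_r.
    destruct (proj1 (filterlim_locally _ _) hL0 (mkposreal 1 Rlt_0_1)) as [d hd].
    assert (hd' : forall r : R, 0 < r < d -> Rabs (Q r / r ^ 2) <= Rabs L0 + 1).
    { intros r hr.
      assert (hb : Rabs (Q r / r ^ 2 - L0) < 1).
      { apply hd; [| easy]. change (Rabs (r - 0) < d).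
        rewrite Rminus_0_r, Rabs_pos_eq; lra. }
      pose proof (Rabs_triang_inv (Q r / r ^ 2) L0). lra. }
    apply filterlim_locally. intros eps.
    set (c := (Rabs L0 + 1) / sigma ^ 4).
    assert (hc : 0 < c).
    { apply Rdiv_lt_0_compat; [pose proof (Rabs_pos L0); lra | easy]. }
    assert (he : 0 < eps / c) by (apply Rdiv_lt_0_compat; [apply cond_pos | easy]).
    assert (hm : 0 < Rmin d (eps / c)) by (apply Rmin_glb_lt; [apply cond_pos | easy]).
    assert (main : forall r : R, Rabs (r - 0) < Rmin d (eps / c) -> 0 <= r <= rmax ->
              Rabs (Q r / (sigma ^ 4 * r) - 0) < eps).
    { intros r hr hr'. rewrite Rminus_0_r in hr |- *. rewrite Rabs_pos_eq in hr by lra.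
      pose proof (Rmin_l d (eps / c)). pose proof (Rmin_r d (eps / c)).
      destruct (Rle_lt_or_eq_dec 0 r (proj1 hr')) as [hr0 | <-].
      - replace (Q r / (sigma ^ 4 * r)) with (Q r / r ^ 2 * (r / sigma ^ 4))
          by (field; lra).
        assert (0 < r / sigma ^ 4) by (apply Rdiv_lt_0_compat; easy).
        rewrite Rabs_mult, (Rabs_pos_eq (r / sigma ^ 4)) by lra.
        apply Rle_lt_trans with (r * c).
        + replace (r * c) with ((Rabs L0 + 1) * (r / sigma ^ 4))
            by (unfold c; field; lra).
          apply Rmult_le_compat_r; [lra | apply hd'; lra].
        + apply Rlt_div_r; [easy | lra].
      - rewrite Rmult_0_r. unfold Rdiv. rewrite Rinv_0, Rmult_0_r, Rabs_R0.
        apply cond_pos. }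
    exists (mkposreal _ hm). exact main.
Qed.

Lemma is_derive_on_of_is_derive (D : R -> Prop) (f : R -> R) (x l : R) :
  D x -> is_derive f x l -> is_derive_on D f x l.
Proof.
  intros hx hf.
  assert (ProperFilter (within D (locally x))).
  { split; [| apply within_filter, locally_filter].
    intros P hP. exists x. now apply (locally_singleton x _ hP). }
  apply (filterdiff_locally f x); [| exact hf].
  intros P hP. now apply filter_le_within.
Qed.

Lemma continuous_on_of_is_derive_on (D : R -> Prop) (f df : R -> R) :
  (forall x, D x -> is_derive_on D f x (df x)) -> continuous_on D f.
Proof.
  intros hf x hx.
  apply (filterdiff_continuous_aux (V := R_NormedModule) (F := within D (locally x))).
  - eexists. apply (hf x hx).
  - intros P hP. now apply filter_le_within.
Qed.

(** * The singular Riccati equation *)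

Theorem theorem5p3 (N : nat) (sigma rmax : R) (Q : R -> R) (L0 : R)
  (hN : (1 <= N)%nat) (hsigma : 0 < sigma) (hrmax : 0 < rmax)
  (hQcont : continuous_on (fun r => 0 <= r <= rmax) Q)
  (hQpos : forall r : R, 0 <= r <= rmax -> 0 <= Q r)
  (hL0pos : 0 < L0)
  (hL0 : filterlim (fun r => Q r / r ^ 2) (at_right 0) (locally L0)) :
  exists phi : R -> R,
    riccati_solution N sigma rmax Q phi /\
    forall psi : R -> R, riccati_solution N sigma rmax Q psi ->
      forall r : R, 0 <= r < rmax -> psi r = phi r.
Proof.
  pose proof (pow_lt sigma 4 hsigma) as hs.
  set (q := fun r => Q r / (sigma ^ 4 * r)).
  set (p := fun r => q (clamp 0 rmax r)).
  assert (hp : forall x, continuous p x).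
  { intros x. apply (continuous_clamp_comp 0 rmax q); [lra |].
    now apply (riccati_source_continuous sigma rmax L0 Q). }
  assert (hpq : forall r, 0 <= r < rmax -> p r = q r).
  { intros r hr. unfold p. rewrite clamp_id; lra. }
  assert (hq0 : q 0 = 0).
  { unfold q, Rdiv. rewrite Rmult_0_r, Rinv_0. apply Rmult_0_r. }
  assert (hp0 : forall x, 0 <= p x).
  { intros x. unfold p. assert (hx := clamp_bounds 0 rmax x (Rlt_le _ _ hrmax)).
    destruct (Rle_lt_or_eq_dec 0 _ (proj1 hx)) as [hx0 | <-]; [| lra].
    apply Rdiv_le_0_compat; [now apply hQpos | now apply Rmult_lt_0_compat]. }
  destruct (riccati_solution_exists N rmax p hrmax hp hp0) as [phi [hphi0 hphi]].
  { rewrite hpq; lra. }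
  assert (hphi' : forall r, 0 < r < rmax ->
     is_derive phi r (- r * phi r ^ 2 - INR N / r * phi r + q r)).
  { intros r hr. rewrite <- hpq by lra.
    replace (INR N / r * phi r) with (INR N * (phi r / r)) by (field; lra).
    apply hphi. lra. }
  exists phi. split.
  - split; [| now split].
    set (dphi := fun r => - r * phi r ^ 2 - INR N * (phi r / r) + p r).
    exists dphi. split.
    + intros r hr.
      assert (hc : continuous phi r) by (eapply continuous_of_is_derive; now apply hphi).
      assert (hslope : continuous (fun x => phi x / x) r).
      { destruct (Rle_lt_or_eq_dec 0 r (proj1 hr)) as [hr0 | <-].
        - apply (continuous_Rmult phi Rinv); [easy |].
          apply (ex_derive_continuous Rinv r). auto_derive. lra.
        - apply continuous_slope_0; [easy |].
          evar_last; [now apply hphi |].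
          rewrite hphi0, hpq, hq0 by lra. unfold Rdiv. ring. }
      apply (continuous_within _ dphi r).
      apply (continuous_plus (fun x => - x * phi x ^ 2 - INR N * (phi x / x)) p);
        [| apply hp].
      apply (continuous_minus (fun x => - x * phi x ^ 2)
               (fun x => INR N * (phi x / x))).
      * apply (continuous_Rmult Ropp (fun x => phi x ^ 2)).
        -- apply (ex_derive_continuous Ropp r). auto_derive. easy.
        -- apply (continuous_comp phi (fun z => z ^ 2)); [easy | apply continuous_pow].
      * apply (continuous_Rmult (fun _ => INR N)); [apply continuous_const | easy].
    + intros r hr. apply is_derive_on_of_is_derive; [easy | now apply hphi].
  - intros psi [[dpsi [_ hdpsi]] [hpsi hpsi0]].
    apply (riccati_unique N rmax q phi psi).
    + intros r hr.
      apply continuous_within.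
      eapply continuous_of_is_derive. now apply hphi.
    + now apply continuous_on_of_is_derive_on with dpsi.
    + easy.
    + exact hpsi.
    + congruence.
Qed.
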